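(* For all integers $n\ge 1$ and $0\le t\le n$, $$m(S_n,t)\ \ge\ \left\lfloor \frac{2n-t+1}{2(n-t+1)}\right\rfloor+1 .$$
   Context: $S_n$ is the symmetric group on $\{1,\dots,n\}$, acting on the right (the image of $i$ under $\pi$ is $i\pi$), with the Hamming distance $d(\pi,\sigma)=|\{i : i\pi\neq i\sigma\}|$. For a nonempty subset $C\subseteq S_n$, the remoteness of $C$ is $r(C)=\min_{v\in S_n}\max_{c\in C} d(v,c)$. For an integer $t$, $m(S_n,t)$ denotes the minimum cardinality of a nonempty $C\subseteq S_n$ with $r(C)\ge t$ (taken to be $+\infty$ if no such $C$ exists). *)

(* Defs.v *)
From HB Require Import structures.
From mathcomp Require Import all_boot all_order all_algebra all_fingroup.
From mathcomp Require Import constructive_ereal.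
Set Implicit Arguments.
Unset Strict Implicit.
Unset Printing Implicit Defensive.
Import Order.TTheory GRing.Theory Num.Theory.
Local Open Scope nat_scope.

(* Permutations are multiplied from left to right, so that [s i] is the image
   of [i] under the right action of [s]. The points are 0, ..., n-1. *)
Definition hamming_dist n (s u : 'S_n) : nat := #|[set i | s i != u i]|.

Definition max_dist n (C : {set 'S_n}) (v : 'S_n) : nat :=
  \max_(c in C) hamming_dist v c.

(* [arg min] only uses the identity as a witness that there is a permutation, so
   this is the minimum of [max_dist C v] over all [v]. It is also defined for
   [C = set0], with value 0, but is only used for nonempty [C]. *)
Definition remoteness n (C : {set 'S_n}) : nat :=
  max_dist C [arg min_(v < 1%g : 'S_n) max_dist C v].

(* The values lie in the integers extended with infinities: the neutral element
   [+oo] of the minimum is the value when no [C] qualifies. *)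
Definition min_card_remoteness (n t : nat) : \bar int :=
  \big[Order.min/+oo%E]_(C : {set 'S_n} | (C != set0) && (t <= remoteness C))
     (#|C|%:Z)%:E.

(* Main.v *)
Require Import Defs.
From HB Require Import structures.
From mathcomp Require Import all_boot all_order all_algebra all_fingroup.
From mathcomp Require Import constructive_ereal.
From mathcomp Require Import zify.

(** A permutation [v] satisfies [d(v, c) < t] exactly when it agrees with [c] in
    at least [s = n - t + 1] points. Since [2 n - t + 1 = n + s], a nonempty set
    of [k] permutations violates the bound exactly when [2 k s <= n + s], that is
    [(2 k - 1) s <= n]. In that case some [v] agrees with each of the [k]
    permutations in at least [s] points ([exists_common_agreement]), and this
    [v] shows that the remoteness of the set is less than [t].

    The permutation [v] is found greedily. Once [j] of the given permutations
    have been served, [v] is committed on a set [A] of [j s] points. For the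
    next permutation [c], the points of [A] are taken, and so are the points
    that [c] sends into the [j s] values [v] has on [A]; at least [n - 2 j s]
    points remain, which is at least [s] because [j < k]. Following [c] on [s]
    of these points keeps the partial map injective, and a partial injection of
    a finite set into itself extends to a permutation ([extend_injection]). *)

(** Correcting a permutation [v] at one further point [x] costs only a
    transposition: [v * tperm (v x) (f x)] sends [x] to [f x] and, by
    injectivity, moves none of the values already prescribed. *)
Lemma extend_injection (T : finType) (D : {set T}) (f : T -> T) :
  {in D &, injective f} -> exists v : {perm T}, {in D, v =1 f}.
Proof.
have [m] := ubnP #|D|; elim: m D => // m IHm D ltDm injf.
have [-> | [x xD]] := set_0Vmem D.
  by exists 1%g => y; rewrite inE.
have [||v vf] := IHm (D :\ x).
- by move: ltDm; rewrite (cardsD1 x) xD.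
- by move=> y z /setD1P[_ yD] /setD1P[_ zD]; apply: injf.
exists (v * tperm (v x) (f x))%g => y yD; rewrite permM.
have [-> | neq_yx] := eqVneq y x; first exact: tpermL.
have vy : v y = f y by apply: vf; rewrite !inE neq_yx.
rewrite tpermD // eq_sym.
  by apply: contraNneq neq_yx => /perm_inj ->.
by rewrite vy; apply: contraNneq neq_yx => /injf ->.
Qed.

(** The set [A] holds the points where the choices made so far fix [v]. The
    induction needs its size, because each point of [A] rules out at most two
    points for the next permutation. *)
Lemma greedy_agreement (T : finType) (s : nat) (cs : seq {perm T}) :
  2 * size cs * s <= #|T| + s ->
  exists (v : {perm T}) (A : {set T}), #|A| = size cs * s /\
    {in cs, forall c : {perm T}, s <= #|[set i in A | v i == c i]|}.
Proof.
elim: cs => [_ | c cs IHcs]; first by exists 1%g, set0; rewrite cards0.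
rewrite /= mulnS mulnDl => lecs.
have [|v [A [cardA agree]]] := IHcs; first by move: #|T| lecs => N; lia.
(* The values of [c] outside [taken] are new to [v], so [c] can be followed
   there without spoiling the agreements already obtained. *)
set taken := A :|: c @^-1: (v @: A).
have le_taken : #|taken| <= 2 * size cs * s.
  have := cardsU A (c @^-1: (v @: A)).
  rewrite -/taken card_preimset; last exact: perm_inj.
  by rewrite card_imset; [lia | exact: perm_inj].
have : s <= #|~: taken| by have := cardsC taken; move: #|T| lecs => N; lia.
case/card_geqP=> b [uniq_b size_b sub_b].
pose B := [set i in b].
have cardB : #|B| = s by rewrite cardsE (card_uniqP uniq_b).
have notA i : i \in B -> i \notin A.
  by rewrite inE => /sub_b; rewrite !inE negb_or => /andP[].
have notvA i j : i \in B -> j \in A -> c i != v j.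
  rewrite inE => /sub_b; rewrite !inE negb_or => /andP[_ nvA] jA.
  by apply: contraNneq nvA => ->; apply: imset_f.
have [|w wf] := extend_injection T (A :|: B)
  (fun i => if i \in A then v i else c i).
  move=> i j /setUP iAB /setUP jAB /=.
  case: ifPn => iA; case: ifPn => jA; try exact: perm_inj.
    case: jAB => [|jB]; first by rewrite (negbTE jA).
    by move/esym/eqP; rewrite (negbTE (notvA _ _ jB iA)).
  case: iAB => [|iB]; first by rewrite (negbTE iA).
  by move/eqP; rewrite (negbTE (notvA _ _ iB jA)).
have wA i : i \in A -> w i = v i by move=> iA; rewrite wf ?inE iA.
have wB i : i \in B -> w i = c i.
  by move=> iB; rewrite wf ?(negbTE (notA _ iB)) // inE iB orbT.
exists w, (A :|: B); split.
  have /eqP AB0 : A :&: B == set0.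
    apply/eqP/setP=> i; rewrite in_setI in_set0; apply/negP=> /andP[iA /notA].
    by rewrite iA.
  by rewrite cardsU AB0 cards0 cardA cardB; lia.
move=> d; rewrite inE => /predU1P[-> | /agree le_s].
  rewrite -{1}cardB; apply/subset_leq_card/subsetP=> i iB.
  by rewrite in_set wB // eqxx in_setU iB orbT.
apply: (leq_trans le_s); apply/subset_leq_card/subsetP=> i.
by rewrite !in_set => /andP[iA /eqP vd]; rewrite iA wA // vd eqxx.
Qed.

Lemma exists_common_agreement (T : finType) (s : nat) (C : {set {perm T}}) :
  2 * #|C| * s <= #|T| + s ->
  exists v : {perm T}, {in C, forall c : {perm T}, s <= #|[set i | v i == c i]|}.
Proof.
rewrite cardE => /greedy_agreement[v [A [_ agree]]].
exists v => c cC; apply: leq_trans (agree c _) _; first by rewrite mem_enum.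
by apply/subset_leq_card/subsetP=> i; rewrite !in_set => /andP[].
Qed.

Lemma hamming_dist_agreement (n : nat) (v c : 'S_n) :
  hamming_dist v c + #|[set i | v i == c i]| = n.
Proof.
rewrite addnC -[RHS](card_ord n) -(cardsC [set i | v i == c i]); congr (_ + _).
by apply: eq_card => i; rewrite !inE.
Qed.

Lemma remoteness_le_max_dist (n : nat) (C : {set 'S_n}) (v : 'S_n) :
  remoteness C <= max_dist C v.
Proof. by rewrite /remoteness; case: arg_minnP => // w _; apply. Qed.

Lemma remoteness_add_le (n s : nat) (C : {set 'S_n}) :
  C != set0 -> 2 * #|C| * s <= n + s -> remoteness C + s <= n.
Proof.
move=> C0 le_n; have C_gt0 : 0 < #|C| by rewrite card_gt0.
have [|v agree] := @exists_common_agreement _ s C; first by rewrite card_ord.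
(* As [#|C| >= 1], the hypothesis leaves room for [s] agreements, so that the
   truncated difference [n - s] is a true one. *)
have le_sn : s <= n by nia.
suff : max_dist C v <= n - s.
  by have := remoteness_le_max_dist n C v; lia.
apply/bigmax_leqP=> c /agree.
by have := hamming_dist_agreement n v c; lia.
Qed.

Theorem proposition6 (n t : nat) (hn : (1 <= n)%N) (ht : (t <= n)%N) :
  (((((2 * n - t + 1) %/ (2 * (n - t + 1)) + 1)%N%:Z)%R)%:E
     <= min_card_remoteness n t)%E.
Proof.
rewrite /min_card_remoteness; set q := _ %/ _.
apply: (big_ind (fun x => (q + 1)%N%:Z%:E <= x)%E)
  => [|x y lex ley|C /andP[C0 le_t]].
- by rewrite leey.
- by rewrite Order.TotalTheory.le_min lex ley.
rewrite lee_fin ssrint.lez_nat addn1 /q ltnNge; apply/negP.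
rewrite leq_divRL; last by lia.
move=> leC; have le_s : 2 * #|C| * (n - t + 1) <= n + (n - t + 1) by lia.
have := remoteness_add_le n (n - t + 1) C C0 le_s.
by move: le_t; lia.
Qed.
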